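(* Consider the following data: (1) $\mathfrak{u}$ is a Lie algebra equipped with a flat torsion-free connection $\nabla$ and a symplectic form $\omega$ such that $\nabla\omega=0$. (2) $\mathfrak{v}$ is a Lie algebra equipped with a flat torsion-free connection $\nabla'$ and a symplectic form $\omega'$ such that $\nabla'\omega'=0$. (3) There exists a linear isomorphism $\varphi:\mathfrak{u}\to\mathfrak{v}$ such that (i) the representations $\rho:\mathfrak{u}\to\mathfrak{gl}(\mathfrak{v})$ and $\mu:\mathfrak{v}\to\mathfrak{gl}(\mathfrak{u})$ defined by $$\rho(x)a=\varphi\nabla_x\varphi^{-1}(a),\qquad \mu(a)x=\varphi^{-1}\nabla'_a\varphi(x)$$ satisfy $$\rho(x)[a,b]-[\rho(x)a,b]-[a,\rho(x)b]+\rho(\mu(a)x)b-\rho(\mu(b)x)a=0,$$ $$\mu(a)[x,y]-[\mu(a)x,y]-[x,\mu(a)y]+\mu(\rho(x)a)y-\mu(\rho(y)a)x=0$$ for all $x,y\in\mathfrak{u}$ and $a,b\in\mathfrak{v}$; (ii) $\omega(x,y)=\omega'(\varphi(x),\varphi(y))$ for all $x,y\in\mathfrak{u}$. In this situation the vector space $\mathfrak{g}=\mathfrak{u}\oplus\mathfrak{v}$ admits a Lie bracket extending the Lie brackets on $\mathfrak{u}$ and $\mathfrak{v}$, and there is a hypersymplectic structure $\{J,E,g\}$ on $\mathfrak{g}$ such that $\mathfrak{g}_+=\mathfrak{u}$ and $\mathfrak{g}_-=\mathfrak{v}$, where $\mathfrak g_{\pm}$ denotes the $(\pm1)$-eigenspace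 of $E$.
   Context: All Lie algebras are finite-dimensional over $\mathbb{R}$. A connection on a Lie algebra $\mathfrak h$ is a bilinear map $\nabla:\mathfrak h\times\mathfrak h\to\mathfrak h$, $(x,y)\mapsto\nabla_xy$; it is torsion-free if $\nabla_xy-\nabla_yx=[x,y]$ and flat if $\nabla_x\nabla_y-\nabla_y\nabla_x=\nabla_{[x,y]}$ for all $x,y$. A 2-form $\omega$ on $\mathfrak h$ is closed if $-\omega([x,y],z)+\omega([x,z],y)-\omega([y,z],x)=0$ for all $x,y,z$; a symplectic form is a nondegenerate closed 2-form. $\nabla\omega=0$ means $\omega(\nabla_xy,z)=\omega(\nabla_xz,y)$ for all $x,y,z\in\mathfrak h$. A complex structure on a Lie algebra $\mathfrak{g}$ is a linear endomorphism $J$ with $J^2=-\mathrm{Id}$ and $J[x,y]=[Jx,y]+[x,Jy]+J[Jx,Jy]$ for all $x,y$. A product structure is a linear endomorphism $E\neq\pm\mathrm{Id}$ with $E^2=\mathrm{Id}$ and $E[x,y]=[Ex,y]+[x,Ey]-E[Ex,Ey]$ for all $x,y$ (equivalently, the $\pm1$-eigenspaces of $E$ are Lie subalgebras). A complex product structure is a pair $\{J,E\}$ of a complex structure and a product structure with $JE=-EJ$. A metric on $\mathfrak g$ is a nondegenerate symmetric bilinear form $g$ on $\mathfrak g$; it is compatible with $\{J,E\}$ if $g(Jx,Jy)=g(x,y)$ and $g(Ex,Ey)=-g(x,y)$ for all $x,y$. If moreover the 2-forms $\omega_1(x,y)=g(Jx,y)$, $\omega_2(x,y)=g(Ex,y)$,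 $\omega_3(x,y)=g(JEx,y)$ are closed, $\{J,E,g\}$ is a hypersymplectic structure on $\mathfrak g$. *)

(* Defs.v *)
From HB Require Import structures.
From mathcomp Require Import all_boot all_order all_algebra.
From mathcomp Require Import reals.

Set Implicit Arguments.
Unset Strict Implicit.
Unset Printing Implicit Defensive.

Import Order.TTheory GRing.Theory Num.Theory.
Local Open Scope ring_scope.

Section LieAlgebras.

Context {R : realType} {h : vectType R}.

(* A Lie algebra is a [vectType] with a bilinear bracket [br] satisfying this. *)
Definition is_lie_bracket (br : {bilinear h -> h -> h}) : Prop :=
  (forall x, br x x = 0) /\
  (forall x y z, br x (br y z) + br y (br z x) + br z (br x y) = 0).

Definition torsion_free (br nabla : {bilinear h -> h -> h}) : Prop :=
  forall x y, nabla x y - nabla y x = br x y.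

Definition flat (br nabla : {bilinear h -> h -> h}) : Prop :=
  forall x y z, nabla x (nabla y z) - nabla y (nabla x z) = nabla (br x y) z.

Definition closed_form (br : {bilinear h -> h -> h}) (om : h -> h -> R) : Prop :=
  forall x y z, - om (br x y) z + om (br x z) y - om (br y z) x = 0.

Definition symplectic_form (br : {bilinear h -> h -> h})
    (om : {skew_symmetric h}) : Prop :=
  nondegenerate om /\ closed_form br om.

Definition parallel_form (nabla : {bilinear h -> h -> h})
    (om : {skew_symmetric h}) : Prop :=
  forall x y z, om (nabla x y) z = om (nabla x z) y.

Definition complex_structure (br : {bilinear h -> h -> h}) (J : 'End(h)) : Prop :=
  (J \o J)%VF = - \1%VF /\
  (forall x y, J (br x y) = br (J x) y + br x (J y) + J (br (J x) (J y))).

Definition product_structure (br : {bilinear h -> h -> h}) (E : 'End(h)) : Prop :=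
  [/\ E <> \1%VF, E <> - \1%VF, (E \o E)%VF = \1%VF &
      forall x y, E (br x y) = br (E x) y + br x (E y) - E (br (E x) (E y))].

Definition complex_product_structure (br : {bilinear h -> h -> h})
    (J E : 'End(h)) : Prop :=
  [/\ complex_structure br J, product_structure br E &
      (J \o E)%VF = - (E \o J)%VF].

Definition compatible_metric (J E : 'End(h)) (g : {symmetric h}) : Prop :=
  [/\ nondegenerate g, forall x y, g (J x) (J y) = g x y &
      forall x y, g (E x) (E y) = - g x y].

Definition hypersymplectic (br : {bilinear h -> h -> h}) (J E : 'End(h))
    (g : {symmetric h}) : Prop :=
  [/\ complex_product_structure br J E,
      compatible_metric J E g,
      closed_form br (fun x y => g (J x) y),
      closed_form br (fun x y => g (E x) y) &
      closed_form br (fun x y => g (J (E x)) y)].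

End LieAlgebras.

Section Conjugation.

Context {R : realType} {u v : vectType R}.

(* [conj_connection f f' nabla x] is the operator [f \o nabla x \o f']; for
   [f] an isomorphism with inverse [f'] it is the transport of [nabla x]. *)
Definition conj_connection (f : u -> v) (f' : v -> u)
    (nabla : {bilinear u -> u -> u}) (x : u) (a : v) : v :=
  f (nabla x (f' a)).

(* One half of the matched-pair conditions; the other half is obtained by
   exchanging the roles of [u] and [v]. *)
Definition matched (brv : {bilinear v -> v -> v})
    (rho : u -> v -> v) (mu : v -> u -> u) : Prop :=
  forall (x : u) (a b : v),
    rho x (brv a b) - brv (rho x a) b - brv a (rho x b)
      + rho (mu a x) b - rho (mu b x) a = 0.

(* [u] and [v] sit in [u * v] as the vectors [(x, 0)] and [(0, a)]. *)
Definition extends_brackets (br : {bilinear (u * v)%type -> (u * v)%type -> (u * v)%type})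
    (bru : {bilinear u -> u -> u}) (brv : {bilinear v -> v -> v}) : Prop :=
  (forall x y : u, br (x, 0) (y, 0) = (bru x y, 0)) /\
  (forall a b : v, br (0, a) (0, b) = (0, brv a b)).

End Conjugation.

(* Main.v *)
Require Import Defs.
From HB Require Import structures.
From mathcomp Require Import all_boot all_order all_algebra.
From mathcomp Require Import reals.
From mathcomp Require Import ring lra.

Set Implicit Arguments.
Unset Strict Implicit.
Unset Printing Implicit Defensive.

Import Order.TTheory GRing.Theory Num.Theory.
Local Open Scope ring_scope.

(** The hypotheses say that [rho] and [mu] make [u] and [v] a matched pair of
Lie algebras: flatness of a connection is the representation property of its
conjugate, and the two remaining identities are the mixed parts of the Jacobi
identity.  The bracket is therefore the bicrossed product, determined by
[[x, a] = rho x a - mu a x] for [x] in [u] and [a] in [v].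

Write [psi] for the inverse of [phi].  The structures are
  [J (x, a) = (- psi a, phi x)],  [E (x, a) = (x, - a)],
  [g ((x, a), (y, b)) = om x (psi b) + om y (psi a)].
The eigenspaces of [E] are subalgebras by construction.  Integrability of [J]
is the torsion-freeness of both connections, read through [phi]: for [x], [y]
in [u], [[J x, y] + [x, J y]] regroups into
[psi [phi x, phi y] + phi [x, y] = J [x, y] - J [J x, J y]].

Since [phi] is symplectic, the three 2-forms are
  [- (om + om')],  [om x (psi b) + om (psi a) y],  [om' - om],
where [om] and [om'] are pulled back along the projections.  The pullback of
[om] is closed because [om] is closed on [u] and [mu] acts by infinitesimal
symplectic maps, which is [nabla' om' = 0] carried to [u]; likewise for [om'].
Closedness of the middle form ([cross_metric_closed_E]) comes from combining
parallelism with torsion-freeness on both sides.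

The bicrossed product is symmetric under exchanging [u] and [v], so the Jacobi
identity and the closedness of the pullbacks are computed on the first factor
([bicross_jacobi_fst], [closed_form_fst]) and transported to the second. *)

(** * Linear algebra *)

(** Reduces an identity between vectors to identities between scalars, where
linear arithmetic applies. *)
Lemma scalar_ext (F : fieldType) (V : vectType F) (x y : V) :
  (forall l : {scalar V}, l x = l y) -> x = y.
Proof.
move=> eq_l; rewrite (coord_vbasis (memvf x)) (coord_vbasis (memvf y)).
by apply: eq_bigr => i _; rewrite (eq_l (coord (vbasis fullv) i)).
Qed.

Lemma nondegenerateP (F : fieldType) (V : vectType F) (eps : bool)
    (f : {hermitian V for eps & idfun}) :
  nondegenerate f <-> (forall x, (forall y, f x y = 0) -> x = 0).
Proof.
split=> [/eqP f0 x fx0|f0].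
  apply/eqP; rewrite -memv0 -f0; apply/mem_orthovP => y _; exact: fx0.
apply/eqP/vspaceP => x; rewrite memv0; apply/mem_orthovP/eqP => [fx0|-> y _].
  by apply: f0 => y; apply: fx0; rewrite memvf.
by rewrite linear0l.
Qed.

Lemma eq_opp0 (R : numFieldType) (V : lmodType R) (x : V) : x = - x -> x = 0.
Proof.
move/eqP; rewrite -addr_eq0 -mulr2n -scaler_nat scaler_eq0 pnatr_eq0 /=.
by move/eqP.
Qed.

Lemma skew_formC (R : fieldType) (V : lmodType R) (om : {skew_symmetric V}) x y :
  om x y = - om y x.
Proof. by rewrite hermC expr1 mulN1r. Qed.

Lemma lie_antisym (R : realType) (h : vectType R) (br : {bilinear h -> h -> h}) :
  is_lie_bracket br -> forall x y, br x y = - br y x.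
Proof.
move=> [br_alt _] x y; apply/eqP; rewrite -addr_eq0; apply/eqP.
have := br_alt (x + y).
by rewrite linearDl !linearDr !br_alt add0r addr0.
Qed.

(** * The bicrossed product of a matched pair *)

Section MatchedPair.
Context {R : realType} {u v : vectType R}.
Variables (bru : {bilinear u -> u -> u}) (brv : {bilinear v -> v -> v}).
Variables (rho : {bilinear u -> v -> v}) (mu : {bilinear v -> u -> u}).

Definition bicross (w w' : u * v) : u * v :=
  (bru w.1 w'.1 + mu w.2 w'.1 - mu w'.2 w.1,
   brv w.2 w'.2 + rho w.1 w'.2 - rho w'.1 w.2).

Fact bicross_bilinear : bilinear_for *:%R *:%R bicross.
Proof.
split=> [[z c] k [x a] [y b]|[z c] k [x a] [y b]];
  rewrite /= /bicross /=; congr pair; rewrite /= ?linearPl ?linearPr;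
  apply: scalar_ext => l; rewrite !(linearD l, linearN l, linearZ) /=; ring.
Qed.

HB.instance Definition _ := bilinear_isBilinear.Build R _ _ _ _ _
  bicross bicross_bilinear.
End MatchedPair.

Definition is_representation (R : realType) (u v : vectType R)
    (br : {bilinear u -> u -> u}) (rho : {bilinear u -> v -> v}) : Prop :=
  forall x y a, rho x (rho y a) - rho y (rho x a) = rho (br x y) a.

(** For a skew form this says [om (rho x a) b + om a (rho x b) = 0]: each [rho x]
lies in the symplectic Lie algebra of [om]. *)
Definition invariant_form (R : realType) (u v : vectType R)
    (rho : {bilinear u -> v -> v}) (om : {skew_symmetric v}) : Prop :=
  forall x a b, om (rho x a) b = om (rho x b) a.

Section BicrossJacobi.
Context {R : realType} {u v : vectType R}.
Variables (bru : {bilinear u -> u -> u}) (brv : {bilinear v -> v -> v}).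
Variables (rho : {bilinear u -> v -> v}) (mu : {bilinear v -> u -> u}).

(** The sum is the Jacobi identity of [u] plus the cyclic rotations of the
matched-pair identity at [(a, y, z)] and of the representation identity at
[(b, c, x)]. *)
Lemma bicross_jacobi_fst :
  is_lie_bracket bru -> is_representation brv mu -> matched bru mu rho ->
  forall X Y Z : u * v, let b := bicross bru brv rho mu in
    (b X (b Y Z) + b Y (b Z X) + b Z (b X Y)).1 = 0.
Proof.
move=> lie_u rep m [x a] [y b] [z c] /=.
have as_u := lie_antisym lie_u; have [_ ju] := lie_u.
rewrite !(linearDr, linearDl, linearNr, linearNl) /=.
apply: scalar_ext => l.
have E := congr1 l (ju x y z).
have Ma := congr1 l (m a y z).
have Mb := congr1 l (m b z x).
have Mc := congr1 l (m c x y).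
have Ra := congr1 l (rep b c x).
have Rb := congr1 l (rep c a y).
have Rc := congr1 l (rep a b z).
move: E Ma Mb Mc Ra Rb Rc.
(* Put the brackets of the matched-pair identities in the order in which
   they occur in the Jacobi sum. *)
rewrite (as_u (mu a y)) (as_u (mu b z)) (as_u (mu c x)).
by rewrite !(linearD l, linearN l, linear0 l) /=; lra.
Qed.

(** The components of a bracket along [mu] cancel in pairs by invariance,
leaving the closedness of [om] on [u]. *)
Lemma closed_form_fst (om : {skew_symmetric u}) :
  closed_form bru om -> invariant_form mu om ->
  closed_form (bicross bru brv rho mu) (fun X Y => om X.1 Y.1).
Proof.
move=> cl inv [x a] [y b] [z c] /=.
rewrite !(linearDl, linearNl) /=.
have := cl x y z; have := inv a y z; have := inv b x z; have := inv c x y.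
lra.
Qed.

End BicrossJacobi.

Section BicrossLie.
Context {R : realType} {u v : vectType R}.
Variables (bru : {bilinear u -> u -> u}) (brv : {bilinear v -> v -> v}).
Variables (rho : {bilinear u -> v -> v}) (mu : {bilinear v -> u -> u}).
Hypotheses (lie_u : is_lie_bracket bru) (lie_v : is_lie_bracket brv).

Lemma bicross_lie :
  is_representation bru rho -> is_representation brv mu ->
  matched brv rho mu -> matched bru mu rho ->
  is_lie_bracket (bicross bru brv rho mu).
Proof.
move=> rep_rho rep_mu m_rho m_mu; split=> [[x a]|[x a] [y b] [z c]].
  by rewrite /= /bicross /= lie_u.1 lie_v.1 !add0r !subrr.
(* Exchanging the factors turns the second component into a first one. *)
have J1 := bicross_jacobi_fst lie_u rep_mu m_mu (x, a) (y, b) (z, c).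
have J2 := bicross_jacobi_fst lie_v rep_rho m_rho (a, x) (b, y) (c, z).
exact: (congr2 pair J1 J2).
Qed.

Lemma bicross_extends : extends_brackets (bicross bru brv rho mu) bru brv.
Proof.
by split=> [x y|a b]; rewrite /= /bicross /= !(linear0l, linear0r) !subr0 !addr0.
Qed.

Lemma closed_form_snd (om' : {skew_symmetric v}) :
  closed_form brv om' -> invariant_form rho om' ->
  closed_form (bicross bru brv rho mu) (fun X Y => om' X.2 Y.2).
Proof.
move=> cl inv [x a] [y b] [z c].
exact: (closed_form_fst bru mu cl inv (a, x) (b, y) (c, z)).
Qed.

End BicrossLie.

(** * The endomorphisms and the metric *)

Section Structures.
Context {R : realType} {u v : vectType R}.
Variables (phi : {linear u -> v}) (psi : {linear v -> u}).

Definition swapJ (w : u * v) : u * v := (- psi w.2, phi w.1).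
Definition reflE (w : u * v) : u * v := (w.1, - w.2).

Fact swapJ_linear : linear swapJ.
Proof. by move=> k [x a] [y b]; rewrite /swapJ /= !linearP. Qed.
HB.instance Definition _ := GRing.isLinear.Build R _ _ _ swapJ swapJ_linear.

Fact reflE_linear : linear reflE.
Proof. by move=> k [x a] [y b]; rewrite /reflE /= opprD -scalerN. Qed.
HB.instance Definition _ := GRing.isLinear.Build R _ _ _ reflE reflE_linear.

Variable om : {skew_symmetric u}.

Definition cross_metric (w w' : u * v) : R :=
  om w.1 (psi w'.2) + om w'.1 (psi w.2).

Fact cross_metric_bilinear :
  bilinear_for (GRing.Scale.Law.clone _ _ *%R _)
    (GRing.Scale.Law.clone _ _ (idfun \; *%R) _) cross_metric.
Proof.
split=> [[z c] k [x a] [y b]|[z c] k [x a] [y b]];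
  rewrite /cross_metric /= !linearP ?linearPl ?linearPr /=; ring.
Qed.
HB.instance Definition _ := bilinear_isBilinear.Build R _ _ _ _ _
  cross_metric cross_metric_bilinear.

Fact cross_metric_sym w w' :
  cross_metric w w' = (-1) ^+ false * idfun (cross_metric w' w).
Proof. by rewrite expr0 mul1r /cross_metric /= addrC. Qed.
HB.instance Definition _ := isHermitianSesquilinear.Build R _ false idfun
  cross_metric cross_metric_sym.

End Structures.

(** * The hypersymplectic structure *)

Section Hypersymplectic.
Context {R : realType} {u v : vectType R}.
Variables (bru : {bilinear u -> u -> u}) (brv : {bilinear v -> v -> v}).
Variables (rho : {bilinear u -> v -> v}) (mu : {bilinear v -> u -> u}).
Variables (phi : {linear u -> v}) (psi : {linear v -> u}).
Hypotheses (phiK : cancel phi psi) (psiK : cancel psi phi).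
(* Torsion-freeness of the two connections, expressed by the actions. *)
Hypothesis tf_u : forall x y, bru x y = psi (rho x (phi y)) - psi (rho y (phi x)).
Hypothesis tf_v : forall a b, brv a b = phi (mu a (psi b)) - phi (mu b (psi a)).
Variables (om : {skew_symmetric u}) (om' : {skew_symmetric v}).
Hypothesis om_phi : forall x y, om x y = om' (phi x) (phi y).
Hypotheses (inv_u : invariant_form mu om) (inv_v : invariant_form rho om').

Let br : {bilinear (u * v)%type -> (u * v)%type -> (u * v)%type} :=
  bicross bru brv rho mu.
Let J : 'End((u * v)%type) := linfun (swapJ phi psi).
Let E : 'End((u * v)%type) := linfun (@reflE R u v).
Let g : {symmetric (u * v)%type} := cross_metric psi om.

Let JE w : J w = (- psi w.2, phi w.1). Proof. exact: lfunE. Qed.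
Let EE w : E w = (w.1, - w.2). Proof. exact: lfunE. Qed.

(** Torsion-freeness rewrites both brackets through [rho] and [mu]; the terms of
the integrability condition then cancel in pairs. *)
Lemma swapJ_complex : complex_structure br J.
Proof.
split=> [|[x a] [y b]].
  apply/lfunP => -[x a]; rewrite comp_lfunE opp_lfunE id_lfunE !JE /=.
  by rewrite phiK linearN psiK.
rewrite !JE /= /bicross /=; congr pair; rewrite /=.
  apply: scalar_ext => l.
  rewrite !(tf_u, tf_v) !(linearNl, linearNr) /=.
  rewrite !(linearD psi, linearN psi, linearN phi, phiK, psiK).
  rewrite !(linearNl, linearNr) /=.
  rewrite !(linearD l, linearN l) /=.
  lra.
apply: (can_inj psiK); apply: scalar_ext => l.
rewrite !(tf_u, tf_v) !(linearNl, linearNr) /=.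
rewrite !(linearD psi, linearN psi, linearN phi, phiK, psiK).
rewrite !(linearNl, linearNr) /=.
rewrite !(linearD psi, linearN psi, phiK, psiK).
rewrite !(linearD l, linearN l) /=.
lra.
Qed.

(** [E = 1] would force [v = 0] and [E = -1] would force [u = 0]; both are excluded
by a nonzero [x] in [u] together with its image [phi x]. *)
Lemma reflE_product : (0 < \dim {:u})%N -> product_structure br E.
Proof.
move=> /[dup] /lt0n_neq0; rewrite dimv_eq0 => u0 _.
have [x _ x0] : exists2 x : u, x \in fullv & x != 0.
  by exists (vpick {:u}); rewrite ?memv_pick ?vpick0.
split.
- move/lfunP/(_ (0, phi x)); rewrite EE id_lfunE => -[] /esym /eq_opp0.
  by move/(congr1 psi); rewrite phiK linear0 => /eqP; rewrite (negPf x0).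
- move/lfunP/(_ (x, 0)); rewrite EE opp_lfunE id_lfunE => -[] /eq_opp0 /eqP.
  by rewrite (negPf x0).
- by apply/lfunP => -[y b]; rewrite comp_lfunE id_lfunE !EE /= opprK.
move=> [y b] [z c]; rewrite !EE /= /bicross /=; congr pair; rewrite /=.
  apply: scalar_ext => l; rewrite !(linearNl, linearNr) /=.
  rewrite !(linearD l, linearN l) /=; lra.
apply: scalar_ext => l; rewrite !(linearNl, linearNr) /=.
rewrite !(linearD l, linearN l) /=; lra.
Qed.

Lemma om_psi a b : om' a b = om (psi a) (psi b).
Proof. by rewrite om_phi !psiK. Qed.

Lemma cross_metric_nondegenerate : nondegenerate om -> nondegenerate g.
Proof.
move=> /nondegenerateP om0; apply/nondegenerateP => -[x a] gx0.
congr pair.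
  apply: om0 => y; have := gx0 (0, phi y).
  by rewrite /= /cross_metric /= phiK linear0l addr0.
apply: (can_inj psiK); rewrite linear0; apply: om0 => y.
have := gx0 (y, 0); rewrite /= /cross_metric /= linear0 linear0r add0r.
by rewrite (skew_formC om) => /eqP; rewrite oppr_eq0 => /eqP.
Qed.

Lemma cross_metric_compatible : nondegenerate om -> compatible_metric J E g.
Proof.
move=> om0; split; first exact: cross_metric_nondegenerate.
  move=> [x a] [y b]; rewrite !JE /= /cross_metric /= !phiK !linearNl /=.
  rewrite (skew_formC om (psi b)) (skew_formC om (psi a)); lra.
move=> [x a] [y b]; rewrite !EE /= /cross_metric /= !(linearN psi) !linearNr /=; lra.
Qed.

(** After eliminating the brackets by torsion-freeness, each operator [rho x],
[mu a] occurs on both sides of [om]; moving it across with its adjoint makes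
the terms cancel in pairs. *)
Lemma cross_metric_closed_E : closed_form br (fun X Y => g (E X) Y).
Proof.
have mu_adj a x y : om (mu a x) y = - om x (mu a y).
  by rewrite inv_u (skew_formC om).
have rho_adj x a y : om (psi (rho x (phi y))) (psi a) = - om y (psi (rho x a)).
  by rewrite -om_psi inv_v om_psi phiK (skew_formC om).
move=> [x a] [y b] [z c]; rewrite !EE /= /cross_metric /= !tf_u !tf_v.
rewrite !(linearDl, linearNl, linearD psi, linearN psi, phiK) /=.
rewrite !(linearDr, linearNr) /= !(mu_adj, rho_adj).
lra.
Qed.

Lemma hypersymplectic_bicross :
  (0 < \dim {:u})%N -> symplectic_form bru om -> symplectic_form brv om' ->
  hypersymplectic br J E g.
Proof.
move=> u_neq0 [om0 cl_u] [_ cl_v].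
have cl_fst := closed_form_fst brv rho cl_u inv_u.
have cl_snd := closed_form_snd bru mu cl_v inv_v.
split; [split | | | |].
- exact: swapJ_complex.
- exact: reflE_product.
- apply/lfunP => -[x a]; rewrite opp_lfunE !comp_lfunE !(JE, EE) /=.
  by rewrite (linearN psi); congr pair; rewrite /= opprK.
- exact: cross_metric_compatible.
- have gJ X Y : g (J X) Y = - om' X.2 Y.2 - om X.1 Y.1.
    rewrite JE /= /cross_metric /= phiK linearNl om_psi (skew_formC om Y.1); lra.
  move=> X Y Z; rewrite !gJ.
  have := cl_fst X Y Z; have := cl_snd X Y Z; rewrite /=; lra.
- exact: cross_metric_closed_E.
have gJE X Y : g (J (E X)) Y = om' X.2 Y.2 - om X.1 Y.1.
  rewrite JE EE /= /cross_metric /= phiK linearN opprK om_psi.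
  rewrite (skew_formC om Y.1); lra.
move=> X Y Z; rewrite !gJE.
have := cl_fst X Y Z; have := cl_snd X Y Z; rewrite /=; lra.
Qed.

Lemma eigenspace_E_1 w : w \in passmx.leigenspace E 1 <-> exists x : u, w = (x, 0).
Proof.
rewrite memv_ker add_lfunE opp_lfunE scale1r id_lfunE EE subr_eq0.
split=> [/eqP|[x ->]]; last by rewrite /= oppr0.
case: w => x a [] /= /esym /eq_opp0 ->; first by exists x.
Qed.

Lemma eigenspace_E_N1 w : w \in passmx.leigenspace E (-1) <-> exists a : v, w = (0, a).
Proof.
rewrite memv_ker add_lfunE opp_lfunE scaleN1r opp_lfunE id_lfunE opprK EE.
rewrite addr_eq0; split=> [/eqP|[a ->]]; last first.
  by apply/eqP; congr pair; rewrite /= oppr0.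
by case: w => x a [] /= /eq_opp0 ->; exists a.
Qed.

End Hypersymplectic.

(** * Conjugated connections *)

Section ConjBilinear.
Context {R : realType} {u v : vectType R}.
Variables (f : {linear u -> v}) (f' : {linear v -> u}).
Variable nabla : {bilinear u -> u -> u}.

Fact conj_connection_bilinear :
  bilinear_for *:%R *:%R (conj_connection f f' nabla).
Proof.
by split=> [a k x y|x k a b]; rewrite /conj_connection ?linearPl !linearP.
Qed.

HB.instance Definition _ := bilinear_isBilinear.Build R u v v _ _
  (conj_connection f f' nabla) conj_connection_bilinear.
End ConjBilinear.

Section ConjConnection.
Context {R : realType} {u v : vectType R}.
Variables (phi : {linear u -> v}) (psi : {linear v -> u}).
Hypotheses (phiK : cancel phi psi) (psiK : cancel psi phi).
Variables (br nabla : {bilinear u -> u -> u}).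

Lemma conj_connection_representation :
  flat br nabla -> is_representation br (conj_connection phi psi nabla).
Proof.
by move=> fl x y a; rewrite /= /conj_connection !phiK -linearB fl.
Qed.

Lemma conj_connection_torsion_free :
  torsion_free br nabla -> forall x y, br x y =
   psi (conj_connection phi psi nabla x (phi y)) -
   psi (conj_connection phi psi nabla y (phi x)).
Proof. by move=> tf x y; rewrite /conj_connection !phiK tf. Qed.

(** An isometry carries the symplectic Lie algebra of [om] to that of [om']. *)
Lemma conj_connection_invariant (om : {skew_symmetric u}) (om' : {skew_symmetric v}) :
  (forall x y : u, om x y = om' (phi x) (phi y)) -> parallel_form nabla om ->
  invariant_form (conj_connection phi psi nabla) om'.
Proof.
move=> om_phi par x a b; rewrite /= /conj_connection.
by rewrite -(psiK b) -om_phi par om_phi !psiK.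
Qed.

End ConjConnection.

Theorem theorem3p5 (R : realType) (u v : vectType R)
  (u_neq0 : (0 < \dim {:u})%N)
  (bru nabla : {bilinear u -> u -> u}) (om : {skew_symmetric u})
  (lie_u : is_lie_bracket bru)
  (flat_u : flat bru nabla) (tf_u : torsion_free bru nabla)
  (sympl_u : symplectic_form bru om) (par_u : parallel_form nabla om)
  (brv nabla' : {bilinear v -> v -> v}) (om' : {skew_symmetric v})
  (lie_v : is_lie_bracket brv)
  (flat_v : flat brv nabla') (tf_v : torsion_free brv nabla')
  (sympl_v : symplectic_form brv om') (par_v : parallel_form nabla' om')
  (phi : {linear u -> v}) (phi_inv : v -> u)
  (phiK : cancel phi phi_inv) (phi_invK : cancel phi_inv phi)
  (matched_rho : matched brv (conj_connection phi phi_inv nabla)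
                             (conj_connection phi_inv phi nabla'))
  (matched_mu : matched bru (conj_connection phi_inv phi nabla')
                            (conj_connection phi phi_inv nabla))
  (om_phi : forall x y : u, om x y = om' (phi x) (phi y)) :
  exists br : {bilinear (u * v)%type -> (u * v)%type -> (u * v)%type},
    [/\ is_lie_bracket br, extends_brackets br bru brv &
     exists (J E : 'End((u * v)%type)) (g : {symmetric (u * v)%type}),
       [/\ hypersymplectic br J E g,
           forall w, w \in passmx.leigenspace E 1 <-> exists x : u, w = (x, 0) &
           forall w, w \in passmx.leigenspace E (-1) <-> exists a : v, w = (0, a)]].
Proof.
have [psi def_psi] : exists psi : {linear v -> u}, phi_inv = psi.
  pose psiL := GRing.isLinear.Build R v u _ phi_inv (can2_linear phiK phi_invK).
  by exists (HB.pack_for {linear v -> u} phi_inv psiL).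
subst phi_inv.
have om_psi a b : om' a b = om (psi a) (psi b) by rewrite om_phi !phi_invK.
pose rho : {bilinear u -> v -> v} := conj_connection phi psi nabla.
pose mu : {bilinear v -> u -> u} := conj_connection psi phi nabla'.
exists (bicross bru brv rho mu); split.
- apply: bicross_lie => //.
    exact: conj_connection_representation.
  exact: conj_connection_representation.
- exact: bicross_extends.
exists (linfun (swapJ phi psi)), (linfun (@reflE R u v)), (cross_metric psi om).
split; last 2 first.
- exact: eigenspace_E_1.
- exact: eigenspace_E_N1.
have tfu := conj_connection_torsion_free phiK tf_u.
have tfv := conj_connection_torsion_free phi_invK tf_v.
have inv_v := conj_connection_invariant phi_invK om_phi par_u.
have inv_u := conj_connection_invariant phiK om_psi par_v.
exact: (hypersymplectic_bicross phiK phi_invK tfu tfv om_phi inv_u inv_v).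
Qed.
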